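(* Let $\varphi:\mathbb{R}\to\mathbb{R}$ be a strictly decreasing symbol for $\mathcal{S}(\mathbb{R})$. Then $\{\lambda\in\mathbb{C}:|\lambda|=1\}\subset\sigma(C_\varphi)$ if and only if $\varphi\circ\varphi\neq I$, where $I$ denotes the identity map of $\mathbb{R}$.
   Context: $\mathcal{S}(\mathbb{R})$ is the Fréchet space of (complex-valued) smooth rapidly decreasing functions on $\mathbb{R}$ (Schwartz space). A smooth function $\varphi:\mathbb{R}\to\mathbb{R}$ is a symbol for $\mathcal{S}(\mathbb{R})$ if the composition operator $C_\varphi: f\mapsto f\circ\varphi$ maps $\mathcal{S}(\mathbb{R})$ continuously into itself. For a continuous linear operator $T:X\to X$ on a Fréchet space $X$, the spectrum $\sigma(T)$ is the set of all $\lambda\in\mathbb{C}$ such that $T-\lambda I:X\to X$ does not admit a continuous linear inverse. *)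

(* Defs.v *)
From HB Require Import structures.
From mathcomp Require Import all_boot all_order all_algebra.
From mathcomp Require Import complex ring.
From mathcomp Require Import all_classical all_reals all_analysis.

Set Implicit Arguments.
Unset Strict Implicit.
Unset Printing Implicit Defensive.

Import Order.TTheory GRing.Theory Num.Theory.
Import numFieldNormedType.Exports.

Local Open Scope classical_set_scope.
Local Open Scope ring_scope.

Section schwartz_functions.
Context {R : realType}.

Definition smooth (f : R -> R) : Prop :=
  forall (n : nat) (x : R), derivable (derive1n n f) x 1.

(* [R[i]] carries no normed module structure over [R] in the library, so the
   derivatives of f = u + i v are taken as u^(n) + i v^(n). *)
Definition csmooth (f : R -> R[i]) : Prop :=
  smooth (fun x => complex.Re (f x)) /\ smooth (fun x => complex.Im (f x)).

Definition cderiv (n : nat) (f : R -> R[i]) (x : R) : R[i] :=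
  Complex (derive1n n (fun y => complex.Re (f y)) x)
          (derive1n n (fun y => complex.Im (f y)) x).

(* |x^k f^(n)(x)| as an element of R: the norm `|_| on R[i] is R[i]-valued *)
Definition weighted (k n : nat) (f : R -> R[i]) (x : R) : R :=
  `|x| ^+ k * Normc.normc (cderiv n f x).

Definition is_schwartz (f : R -> R[i]) : Prop :=
  csmooth f /\ forall k n : nat, has_ubound (range (weighted k n f)).

Definition schwartz_pred : {pred R -> R[i]} := mem [set f | is_schwartz f].

Lemma derive1n_lin (a b : R) (u v : R -> R) (n : nat) : smooth u -> smooth v ->
  derive1n n (fun x => a * u x + b * v x) =
  (fun x => a * derive1n n u x + b * derive1n n v x).
Proof.
move=> su sv; elim: n => [//|n IH].
rewrite !derive1nS IH; apply/funext => x.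
rewrite !derive1E.
have -> : (fun x0 => a * derive1n n u x0 + b * derive1n n v x0) =
   (a \*: derive1n n u) + (b \*: derive1n n v) by apply/funext.
rewrite deriveD; [|exact: derivableZ|exact: derivableZ].
by rewrite !deriveZ.
Qed.

Lemma smooth_lin (a b : R) (u v : R -> R) : smooth u -> smooth v ->
  smooth (fun x => a * u x + b * v x).
Proof.
move=> su sv n x; rewrite derive1n_lin//.
have -> : (fun x0 => a * derive1n n u x0 + b * derive1n n v x0) =
   (a \*: derive1n n u) + (b \*: derive1n n v) by apply/funext.
by apply: derivableD; exact: derivableZ.
Qed.

Lemma derive1n_lin3 (a b : R) (u v w : R -> R) (n : nat) :
  smooth u -> smooth v -> smooth w ->
  derive1n n (fun x => 1 * (a * u x + b * v x) + 1 * w x) =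
  (fun x => 1 * (a * derive1n n u x + b * derive1n n v x) + 1 * derive1n n w x).
Proof.
move=> su sv sw; rewrite (@derive1n_lin 1 1 _ _ n (@smooth_lin a b _ _ su sv) sw).
by rewrite derive1n_lin.
Qed.

Let re_lin (a : R[i]) (f g : R -> R[i]) :
  (fun x => complex.Re ((a *: f + g) x)) =
  (fun x => 1 * (complex.Re a * complex.Re (f x) +
     (- complex.Im a) * complex.Im (f x)) + 1 * complex.Re (g x)).
Proof.
apply/funext => x; rewrite [(a *: f + g) x]/(a * f x + g x).
by case: a (f x) (g x) => [a1 a2] [f1 f2] [g1 g2] /=; ring.
Qed.

Let im_lin (a : R[i]) (f g : R -> R[i]) :
  (fun x => complex.Im ((a *: f + g) x)) =
  (fun x => 1 * (complex.Im a * complex.Re (f x) +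
     complex.Re a * complex.Im (f x)) + 1 * complex.Im (g x)).
Proof.
apply/funext => x; rewrite [(a *: f + g) x]/(a * f x + g x).
by case: a (f x) (g x) => [a1 a2] [f1 f2] [g1 g2] /=; ring.
Qed.

Lemma csmooth_lin (a : R[i]) (f g : R -> R[i]) : csmooth f -> csmooth g ->
  csmooth (a *: f + g).
Proof.
move=> [fr fi] [gr gi]; split.
  rewrite re_lin.
  exact: (@smooth_lin 1 1 _ _ (@smooth_lin (complex.Re a) (- complex.Im a) _ _ fr fi) gr).
rewrite im_lin.
exact: (@smooth_lin 1 1 _ _ (@smooth_lin (complex.Im a) (complex.Re a) _ _ fr fi) gi).
Qed.

Lemma cderiv_lin (n : nat) (a : R[i]) (f g : R -> R[i]) (x : R) :
  csmooth f -> csmooth g ->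
  cderiv n (a *: f + g) x = a * cderiv n f x + cderiv n g x.
Proof.
move=> [fr fi] [gr gi]; rewrite /cderiv re_lin im_lin.
rewrite (@derive1n_lin3 _ _ _ _ _ n fr fi gr) (@derive1n_lin3 _ _ _ _ _ n fr fi gi).
move: (derive1n n _ x) (derive1n n _ x) (derive1n n _ x) (derive1n n _ x).
case: a => [a1 a2] u v w z /=.
by apply/eqP; rewrite eq_complex /=; apply/andP; split; apply/eqP; ring.
Qed.

Lemma normc_ge0 (z : R[i]) : 0 <= Normc.normc z.
Proof. by case: z => a b; exact: sqrtr_ge0. Qed.

Lemma normcD (z w : R[i]) :
  Normc.normc (z + w) <= Normc.normc z + Normc.normc w.
Proof. exact: (ler_normD (z : Rcomplex R) w). Qed.

Lemma weighted_ge0 k n f x : 0 <= weighted k n f x.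
Proof. by rewrite mulr_ge0 ?exprn_ge0 ?normc_ge0. Qed.

Lemma weighted_lin k n (a : R[i]) (f g : R -> R[i]) x :
  csmooth f -> csmooth g ->
  weighted k n (a *: f + g) x <=
    Normc.normc a * weighted k n f x + weighted k n g x.
Proof.
move=> sf sg; rewrite /weighted cderiv_lin//.
rewrite mulrCA -Normc.normcM -mulrDr ler_wpM2l ?exprn_ge0//.
exact: normcD.
Qed.

Lemma cderiv0 n x : cderiv n (0 : R -> R[i]) x = 0.
Proof.
have c0 m : derive1n m (fun=> 0 : R) = (fun=> 0 : R).
  elim: m => // m IH; rewrite derive1nS IH; apply/funext => y.
  by rewrite derive1E derive_cst.
by rewrite /cderiv !c0.
Qed.

Lemma csmooth0 : csmooth 0.
Proof.
have c0 m : derive1n m (fun=> 0 : R) = (fun=> 0 : R).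
  elim: m => // m IH; rewrite derive1nS IH; apply/funext => y.
  by rewrite derive1E derive_cst.
by split=> n x; rewrite c0; exact: derivable_cst.
Qed.

Lemma schwartz_submod_closed : submod_closed schwartz_pred.
Proof.
split.
  apply/mem_set; split=> [|k n]; first exact: csmooth0.
  by exists 0 => _ [x _ <-]; rewrite /weighted cderiv0 Normc.normc0 mulr0.
move=> a f g /set_mem[sf bf] /set_mem[sg bg]; apply/mem_set.
split=> [|k n]; first exact: csmooth_lin.
have [Mf hf] := bf k n; have [Mg hg] := bg k n.
exists (Normc.normc a * Mf + Mg) => _ [x _ <-].
apply: (le_trans (weighted_lin _ _ _ _ sf sg)).
apply: lerD; last by apply: hg; exists x.
by apply: ler_wpM2l; [exact: normc_ge0|apply: hf; exists x].
Qed.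

HB.instance Definition _ := GRing.isSubmodClosed.Build _ _ schwartz_pred
  schwartz_submod_closed.

End schwartz_functions.

Record schwartz (R : realType) := Schwartz {
  schwartz_fun :> R -> R[i] ;
  schwartzP : schwartz_fun \in schwartz_pred }.

HB.instance Definition _ (R : realType) :=
  [isSub of schwartz R for @schwartz_fun R].
HB.instance Definition _ (R : realType) := [Choice of schwartz R by <:].
HB.instance Definition _ (R : realType) :=
  [SubChoice_isSubLmodule of schwartz R by <:].

Section schwartz_topology.
Context {R : realType}.
Implicit Types f g h : schwartz R.

Definition seminorm (k n : nat) (f : schwartz R) : R :=
  sup (range (weighted k n f)).

Definition seminorm_ball (f : schwartz R) (N : nat) (e : R) : set (schwartz R) :=
  [set g | forall k n, (k <= N)%N -> (n <= N)%N -> seminorm k n (g - f) < e].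

Definition schwartz_nbhs (f : schwartz R) : set_system (schwartz R) :=
  [set A | exists N : nat, exists2 e : R, 0 < e & seminorm_ball f N e `<=` A].

Lemma schwartz_csmooth f : csmooth f.
Proof. by have /set_mem[] := schwartzP f. Qed.

Lemma seminorm_ub k n f x : weighted k n f x <= seminorm k n f.
Proof.
apply: ub_le_sup; last by exists x.
by have /set_mem[_ ] := schwartzP f; apply.
Qed.

Lemma seminorm_le k n f M : (forall x, weighted k n f x <= M) ->
  seminorm k n f <= M.
Proof.
move=> h; apply: ge_sup; first by exists (weighted k n f 0), 0.
by move=> _ [x _ <-].
Qed.

Lemma seminorm_ge0 k n f : 0 <= seminorm k n f.
Proof. exact: le_trans (weighted_ge0 _ _ _ 0) (seminorm_ub _ _ _ _). Qed.

Lemma seminorm_lin k n (a : R[i]) f g :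
  seminorm k n (a *: f + g) <= Normc.normc a * seminorm k n f + seminorm k n g.
Proof.
apply: seminorm_le => x.
apply: (le_trans (weighted_lin _ _ _ _
  (schwartz_csmooth f) (schwartz_csmooth g))).
apply: lerD; last exact: seminorm_ub.
by apply: ler_wpM2l; [exact: normc_ge0|exact: seminorm_ub].
Qed.

Lemma seminorm0 k n : seminorm k n 0 = 0.
Proof.
apply/eqP; rewrite eq_le seminorm_ge0 andbT; apply: seminorm_le => x.
by rewrite /weighted cderiv0 Normc.normc0 mulr0.
Qed.

Lemma seminormD k n f g :
  seminorm k n (f + g) <= seminorm k n f + seminorm k n g.
Proof.
by have := seminorm_lin k n 1 f g; rewrite scale1r Normc.normc1 mul1r.
Qed.

Lemma seminormZ k n (a : R[i]) f :
  seminorm k n (a *: f) <= Normc.normc a * seminorm k n f.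
Proof. by have := seminorm_lin k n a f 0; rewrite !addr0 seminorm0 addr0. Qed.

Lemma seminorm_ballxx f N e : 0 < e -> seminorm_ball f N e f.
Proof. by move=> e0 k n _ _; rewrite subrr seminorm0. Qed.

HB.instance Definition _ := hasNbhs.Build (schwartz R) schwartz_nbhs.

Let nbhs_filter f : ProperFilter (nbhs f).
Proof.
split; first by move=> [N [e e0 /(_ f)]]; apply; exact: seminorm_ballxx.
split=> [|A B [N [e e0 NA]] [M [d d0 MB]]|A B AB [N [e e0 NA]]].
- by exists 0%N, 1.
- exists (maxn N M), (Num.min e d); first by rewrite lt_min e0.
  move=> g hg; split.
    apply: NA => k n kN nN; have := hg k n.
    by rewrite !leq_max kN nN lt_min => /(_ isT isT) /andP[].
  apply: MB => k n kN nN; have := hg k n.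
  by rewrite !leq_max kN nN !orbT lt_min => /(_ isT isT) /andP[].
- by exists N, e => //; exact: subset_trans AB.
Qed.

Let nbhs_singleton f (A : set (schwartz R)) : nbhs f A -> A f.
Proof. by move=> [N [e e0]]; apply; exact: seminorm_ballxx. Qed.

Let nbhs_nbhs f (A : set (schwartz R)) : nbhs f A -> nbhs f (nbhs^~ A).
Proof.
move=> [N [e e0 NA]]; exists N, (e / 2); first by rewrite divr_gt0.
move=> g hg; exists N, (e / 2); first by rewrite divr_gt0.
move=> h hh; apply: NA => k n kN nN.
have -> : h - f = (h - g) + (g - f) by rewrite addrA subrK.
rewrite (le_lt_trans (seminormD _ _ _ _))// [ltRHS]splitr.
by rewrite ltrD ?hg ?hh.
Qed.

HB.instance Definition _ := Nbhs_isNbhsTopological.Build (schwartz R)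
  nbhs_filter nbhs_singleton nbhs_nbhs.

Lemma schwartz_nbhsP f (A : set (schwartz R)) : nbhs f A <->
  exists N : nat, exists2 e : R, 0 < e & seminorm_ball f N e `<=` A.
Proof. by []. Qed.

Let add_continuous : continuous (fun x : schwartz R * schwartz R => x.1 + x.2).
Proof.
move=> [f g] A [N [e e0 NA]] /=.
exists (seminorm_ball f N (e / 2), seminorm_ball g N (e / 2)).
  by split; exists N, (e / 2); rewrite ?divr_gt0.
move=> [f' g'] [/= hf hg]; apply: NA => k n kN nN /=.
have -> : f' + g' - (f + g) = (f' - f) + (g' - g) by rewrite addrACA opprD.
rewrite (le_lt_trans (seminormD _ _ _ _))// [ltRHS]splitr.
by rewrite ltrD ?hf ?hg.
Qed.

Let seminorm_bounded f N : exists2 M : R, 0 < M &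
  forall k n, (k <= N)%N -> (n <= N)%N -> seminorm k n f < M.
Proof.
exists (1 + \sum_(k < N.+1) \sum_(n < N.+1) seminorm k n f).
  rewrite ltr_pwDl// sumr_ge0// => k _; rewrite sumr_ge0// => n _.
  exact: seminorm_ge0.
move=> k n kN nN; rewrite ltr_pwDl//.
have kN' : (k < N.+1)%N by []. have nN' : (n < N.+1)%N by [].
rewrite (bigD1 (Ordinal kN'))//= (bigD1 (Ordinal nN'))//= -addrA lerDl.
by rewrite addr_ge0// sumr_ge0// => i _; rewrite ?sumr_ge0// => *;
  exact: seminorm_ge0.
Qed.

Let scale_continuous :
  continuous (fun z : R[i]^o * schwartz R => z.1 *: z.2).
Proof.
move=> [a f] A [N [e e0 NA]] /=.
have [M M0 hM] := seminorm_bounded f N.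
pose L := Normc.normc a + 1.
have L0 : 0 < L by rewrite ltr_wpDl ?normc_ge0.
pose d := Num.min 1 (e / 2 / M).
have d0 : 0 < d by rewrite lt_min ltr01/= !divr_gt0.
exists ([set b : R[i]^o | Normc.normc (b - a : R[i]) < d],
        seminorm_ball f N (e / 2 / L)).
  split; last by exists N, (e / 2 / L); rewrite ?divr_gt0.
  exists (real_complex R d); first by rewrite /= ltcR.
  by move=> b /=; rewrite distrC -ltcR.
move=> [b g] [/= hb hg]; apply: NA => k n kN nN /=.
have -> : b *: g - a *: f = b *: (g - f) + ((b : R[i]) - a) *: f.
  by rewrite scalerBr scalerBl addrA subrK.
rewrite (le_lt_trans (seminorm_lin _ _ _ _ _))// [ltRHS]splitr ler_ltD//.
  have bL : Normc.normc b <= L.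
    rewrite (_ : b = a + (b - a) :> R[i]); last by rewrite addrC subrK.
    rewrite (le_trans (normcD _ _))// lerD2l.
    by apply/ltW/(lt_le_trans hb); rewrite ge_min lexx.
  apply: (@le_trans _ _ (L * seminorm k n (g - f))).
    by rewrite ler_wpM2r// seminorm_ge0.
  by rewrite mulrC -ler_pdivlMr//; exact/ltW/hg.
rewrite (le_lt_trans (seminormZ _ _ _ _))//.
apply: (@le_lt_trans _ _ (d * seminorm k n f)).
  by rewrite ler_wpM2r ?seminorm_ge0// ltW.
apply: (@lt_le_trans _ _ (d * M)); first by rewrite ltr_pM2l ?hM.
by rewrite -ler_pdivlMr// ge_min lexx orbT.
Qed.

Let seminorm_ball_open f N e : open (seminorm_ball f N e).
Proof.
rewrite openE => g hg; rewrite /interior.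
have h (p : 'I_N.+1 * 'I_N.+1) :
    \forall h \near g, seminorm p.1 p.2 (h - f) < e.
  have := hg _ _ (ltn_ord p.1) (ltn_ord p.2).
  rewrite -subr_gt0 => pe.
  exists N; exists (e - seminorm p.1 p.2 (g - f)) => //.
  move=> h hh; have -> : h - f = (h - g) + (g - f) by rewrite addrA subrK.
  by rewrite (le_lt_trans (seminormD _ _ _ _))// -ltrBrDr hh// -ltnS.
apply: filterS (filter_forall _ h) => h' H k n kN nN.
have kN' : (k < N.+1)%N by []. have nN' : (n < N.+1)%N by [].
exact: (H (Ordinal kN', Ordinal nN')).
Qed.

Let seminorm_ball_convex f N e : convex_set (seminorm_ball f N e).
Proof.
apply/convex_setW => g h /set_mem hg /set_mem hh l l0 l1.
apply/mem_set => k n kN nN.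
have nl : (Normc.normc (l%:num : R[i]))%:C%C = l%:num by exact: gtr0_norm.
have nl1 : (Normc.normc (1 - l%:num : R[i]))%:C%C = 1 - l%:num.
  by apply: gtr0_norm; rewrite subr_gt0.
have p0 : 0 < Normc.normc (l%:num : R[i]) by rewrite -ltcR nl.
have q0 : 0 < Normc.normc (1 - l%:num : R[i]) by rewrite -ltcR nl1 subr_gt0.
have pq : Normc.normc (l%:num : R[i]) + Normc.normc (1 - l%:num : R[i]) = 1.
  by apply: complexI; rewrite rmorphD /= nl nl1 addrC subrK.
rewrite (_ : _ - f = (l%:num : R[i]) *: (g - f) + (1 - l%:num) *: (h - f)).
  rewrite (le_lt_trans (seminorm_lin _ _ _ _ _))//.
  rewrite (le_lt_trans (lerD (lexx _) (seminormZ _ _ _ _)))//.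
  rewrite -[ltRHS]mul1r -[X in X * e]pq mulrDl.
  by apply: ltrD; rewrite ltr_pM2l//; [exact: hg|exact: hh].
rewrite !scalerBr addrACA -opprD -scalerDl.
by rewrite [l%:num + _]addrC subrK scale1r.
Qed.

Let locally_convex : exists2 B : set_system (schwartz R),
  (forall b, b \in B -> convex_set b) & basis B.
Proof.
exists [set b | exists f N e, b = seminorm_ball f N e].
  by move=> b /set_mem[f [N [e ->]]]; exact: seminorm_ball_convex.
split; first by move=> b [f [N [e ->]]]; exact: seminorm_ball_open.
move=> f A [N [e e0 NA]]; exists (seminorm_ball f N e) => //.
by split; [exists f, N, e|exact: seminorm_ballxx].
Qed.

HB.instance Definition _ :=
  PreTopologicalNmodule_isTopologicalNmodule.Build (schwartz R) add_continuous.
HB.instance Definition _ :=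
  TopologicalNmodule_isTopologicalLmodule.Build R[i] (schwartz R)
    scale_continuous.
(* this factory only derives the uniform structure *)
HB.instance Definition _ := PreTopologicalLmod_isTvs.Build R[i] (schwartz R)
  add_continuous scale_continuous locally_convex.
HB.instance Definition _ :=
  Uniform_isTvs.Build R[i] (schwartz R) locally_convex.

End schwartz_topology.

Record symbol (R : realType) (phi : R -> R) : Prop := Symbol {
  symbol_smooth : smooth phi ;
  symbol_comp : forall f : schwartz R, (fun x => f (phi x)) \in schwartz_pred ;
  symbol_continuous : continuous (fun f => Schwartz (symbol_comp f)) }.

Definition comp_op (R : realType) (phi : R -> R) (hphi : symbol phi)
    (f : schwartz R) : schwartz R :=
  Schwartz (symbol_comp hphi f).

Lemma comp_op_is_linear (R : realType) (phi : R -> R) (hphi : symbol phi) :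
  linear (comp_op hphi).
Proof. by move=> a f g; apply: val_inj. Qed.

HB.instance Definition _ (R : realType) (phi : R -> R) (hphi : symbol phi) :=
  GRing.isLinear.Build R[i] (schwartz R) (schwartz R) *:%R (comp_op hphi)
    (comp_op_is_linear hphi).

Definition spectrum (K : numFieldType) (E : tvsType K) (T : {linear E -> E}) :
    set K :=
  [set l | ~ exists S : {linear E -> E},
    [/\ continuous S, cancel (fun f => T f - l *: f) S
      & cancel S (fun f => T f - l *: f)]].

(* Main.v *)
Require Import Defs.
From HB Require Import structures.
From mathcomp Require Import all_boot all_order all_algebra.
From mathcomp Require Import complex ring lra.
From mathcomp Require Import all_classical all_reals all_analysis.

Import Order.TTheory GRing.Theory Num.Theory.
Import numFieldNormedType.Exports.

Local Open Scope classical_set_scope.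
Local Open Scope ring_scope.

(** Write psi = phi o phi, an increasing bijection of the line.

    If psi is the identity then T = C_phi is an involution, and T - l is
    invertible as soon as l ^+ 2 != 1, because (T - l)(T + l) = 1 - l ^+ 2; the
    unimodular number l = i is therefore outside the spectrum
    ([not_spectrum_involution]).

    Suppose psi is not the identity and |l| = 1.  The operator T - l is not
    surjective.  Applying the equation f o phi - l f = g twice gives the
    cohomological equation f o psi = l^2 f + k with k = l g + g o phi.  Since
    phi reverses the order, psi moves some point p to the right.  The orbits
    under psi of p and of a point y between p and psi p interlace, in positive
    and in negative time; f is continuous and vanishes at infinity, so that the
    difference of the values of f along the two orbits tends to 0 at both ends
    (lemma [schwartz_interlaced_eq]).  If g is a bump supported in [p, psi p],
    then k vanishes on both orbits except at y: the fixed point of phi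
    separates the orbits from their images under phi, which therefore avoid the
    support of g.  Hence, away from time 0, each step of psi multiplies that
    difference by the unimodular number l^2; its modulus is constant and tends
    to 0, so f y = f p and f (psi y) = f (psi p).  Comparing, k y = 0
    ([cohomological_eq0]), whereas k y = l * g y is not 0.

    Two ingredients remain.  A Schwartz bump is built from exp (- 1 / x), whose
    derivatives stay in the span of the functions x^(-k) exp (- 1 / x).
    Negative time requires phi to be onto: if phi had a finite limit c at an end
    of the line, then g o phi would not decay there for a bump g around c. *)

(** * Smooth functions and bumps *)

Section smooth_functions.
Context {R : realType}.
Implicit Types (f g : R -> R) (S : set (R -> R)).

(** Induction on the order of derivation, carried by the whole class [S]. *)
Lemma smooth_of_stable S :
  (forall f, S f -> exists2 f', S f' & forall x : R, is_derive x 1 f (f' x)) ->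
  forall f, S f -> smooth f.
Proof.
move=> HS f Sf n.
have Sn m : S (derive1n m f).
  elim: m => [//|m IH]; have [f' Sf' df] := HS _ IH.
  rewrite derive1nS (_ : derive1 _ = f')//.
  by apply/funext => x; rewrite derive1E; exact: derive_val.
by move=> x; have [f' _ df] := HS _ (Sn n); exact: ex_derive.
Qed.

Lemma smooth_continuous f : smooth f -> continuous f.
Proof.
by move=> sf x; apply/differentiable_continuous/derivable1_diffP/(sf 0%N).
Qed.

Lemma smooth_derive1n n f : smooth f -> smooth (derive1n n f).
Proof.
by move=> sf m x; rewrite /derive1n -iterD; exact: (sf (m + n)%N).
Qed.

Inductive generated S : (R -> R) -> Prop :=
| gen_base f : S f -> generated S f
| gen_cst (c : R) : generated S (cst c)
| gen_add f g : generated S f -> generated S g -> generated S (f \+ g)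
| gen_mul f g : generated S f -> generated S g -> generated S (f \* g).

(** Smoothness of sums and products comes for free this way: the algebra
    generated by [S] is stable under derivation once the derivatives of its
    generators lie in it, so the Leibniz formula of higher order is avoided. *)
Lemma generated_smooth S :
  (forall f, S f ->
     exists2 f', generated S f' & forall x : R, is_derive x 1 f (f' x)) ->
  forall f, generated S f -> smooth f.
Proof.
move=> HS; apply: smooth_of_stable => f.
elim=> {f} [f /HS//|c|f g _ [f' Sf df] _ [g' Sg dg]|
            f g genf [f' Sf df] geng [g' Sg dg]].
- by exists (cst 0); [exact: gen_cst|move=> x; exact: is_derive_cst].
- exists (f' \+ g'); first exact: gen_add.
  by move=> x; exact: is_deriveD.
- exists ((f \* g') \+ (g \* f')); first by apply: gen_add; exact: gen_mul.
  by move=> x; exact: is_deriveM.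
Qed.

Lemma is_derive0_quadratic f (C : R) :
  (forall x, `|f x| <= C * x ^+ 2) -> is_derive (0 : R) 1 f 0.
Proof.
move=> fC; have f0 : f 0 = 0.
  apply/normr0_eq0/eqP; rewrite eq_le normr_ge0 andbT (le_trans (fC 0))//.
  by rewrite expr0n mulr0.
apply/is_derive1_caratheodory; exists (fun x => f x / x); split.
- move=> z; rewrite f0 !subr0.
  have [->|z0] := eqVneq z 0; first by rewrite f0 mulr0.
  by rewrite divfK.
- suff : f x / x @[x --> (0 : R)] --> (0 : R).
    by move=> h; rewrite /prop_for /continuous_at f0 mul0r.
  apply/norm_cvg0P.
  have Ch (x : R) : `|f x / x| <= C * `|x|.
    have [->|x0] := eqVneq x 0; first by rewrite f0 mul0r normr0 mulr0.
    rewrite normrM normfV ler_pdivrMr ?normr_gt0// -mulrA -expr2.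
    by rewrite real_normK ?num_real.
  apply: (@squeeze_cvgr _ _ _ _ (cst 0) (fun x : R => C * `|x|)).
  + by near=> x; rewrite /= normr_ge0 Ch.
  + exact: cvg_cst.
  + rewrite [X in _ --> X](_ : 0 = C * `|0 : R|); last by rewrite normr0 mulr0.
    by apply: cvgM; [exact: cvg_cst|apply: cvg_norm; exact: cvg_id].
- by rewrite f0 mul0r.
Unshelve. all: by end_near. Qed.

(** The powers [x^-1 ^+ k] are there to make the family closed under derivation
    up to linear combinations. *)
Definition flat (k : nat) (x : R) : R :=
  if 0 < x then x^-1 ^+ k * expR (- x^-1) else 0.

(** With t = 1 / x this is t ^ (k + 2) <= (k + 2)! exp t, a term of the
    exponential series. *)
Lemma flat_le k x : `|flat k x| <= k.+2`!%:R * x ^+ 2.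
Proof.
rewrite /flat; case: ifPn => [x0|_]; last by rewrite normr0 mulr_ge0// sqr_ge0.
have t0 : 0 < x^-1 by rewrite invr_gt0.
rewrite ger0_norm; last by rewrite mulr_ge0 ?expR_ge0// exprn_ge0// ltW.
have := expR_ge1Dxn k.+1 (ltW t0).
rewrite expRN ler_pdivrMr ?expR_gt0// => h.
have : x^-1 ^+ k.+2 <= k.+2`!%:R * expR x^-1.
  rewrite mulrC -ler_pdivrMr ?ltr0n ?fact_gt0//.
  by apply: le_trans h; rewrite lerDr.
move=> h2; rewrite mulrAC -ler_pdivrMr ?exprn_gt0//.
by apply: le_trans h2; rewrite -exprVn -exprD addn2.
Qed.

(** The formula is the usual computation for x > 0; at 0 the derivative vanishes
    because [flat k] is quadratically small there. *)
Lemma is_derive_flat k (x : R) :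
  is_derive x 1 (flat k) (flat k.+2 x - k%:R * flat k.+1 x).
Proof.
have [x0|x0|->] := ltgtP x 0.
- rewrite (_ : _ - _ = 0 :> R); last first.
    by rewrite /flat ltNge (ltW x0)/= mulr0 subr0.
  apply: (@near_eq_is_derive _ _ _ (cst 0)).
  by near=> y; rewrite /flat ltNge ltW//; near: y; exact: lt_nbhsl.
- rewrite (_ : _ - _ = x^-1 ^+ k.+2 * expR (- x^-1) -
      k%:R * (x^-1 ^+ k.+1 * expR (- x^-1))); last by rewrite /flat x0.
  have dV : is_derive x 1 (fun y : R => y^-1) (- x ^- 2).
    have := @is_deriveV R id x 1 1 (lt0r_neq0 x0) (is_derive_id x 1).
    by rewrite /GRing.scale/= mulr1.
  have D1 := @is_deriveX R R (fun y : R => y^-1) k x 1 _ dV.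
  have D2 := @is_derive1_comp R expR (fun y : R => - y^-1) x _ _
    (is_derive_expR _) (is_deriveN dV).
  have D3 := is_deriveM D1 D2.
  have near_flat : \forall y \near x,
      (((fun y : R => y^-1) ^+ k) * (expR \o (fun y : R => - y^-1))) y
      = flat k y.
    near=> y; rewrite /flat ifT; last by near: y; exact: lt_nbhsr.
    by rewrite /GRing.mul /= exprfctE.
  apply: is_derive_eq (near_eq_is_derive near_flat D3) _.
  rewrite exprfctE /= /GRing.scale /= exprVn.
  case: (k) => [|m]; first by rewrite !mul0r !expr0; ring.
  by rewrite -!exprVn !exprS; ring.
- rewrite (_ : _ - _ = 0 :> R); last by rewrite /flat ltxx mulr0 subr0.
  exact: is_derive0_quadratic (flat_le k).
Unshelve. all: by end_near. Qed.

Lemma generated_flat_smooth f :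
  generated [set g | exists k a b, g = fun x => flat k (a * x + b)] f ->
  smooth f.
Proof.
apply: generated_smooth => _ [k [a [b ->]]].
pose l m : R -> R := fun x => flat m (a * x + b).
have gl m :
    generated [set g | exists k a b, g = fun x => flat k (a * x + b)] (l m).
  by apply: gen_base; exists m, a, b.
exists (cst a \* (l k.+2 \+ (cst (- k%:R) \* l k.+1))).
  by repeat first
    [apply: gen_mul|apply: gen_add|exact: gen_cst|exact: gl].
move=> x; have da : is_derive x 1 (fun y : R => a * y + b) a.
  have := is_deriveD (is_deriveZ a (is_derive_id x 1)) (is_derive_cst b x 1).
  by rewrite addr0 /GRing.scale /= mulr1.
apply: is_derive_eq (is_derive1_comp (is_derive_flat k _) da) _.
by rewrite /l /=; ring.
Qed.

Definition bump (p q x : R) : R := flat 0 (x - p) * flat 0 (q - x).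

Lemma bump_smooth p q : smooth (bump p q).
Proof.
apply: generated_flat_smooth.
rewrite (_ : bump p q =
  (fun x => flat 0 (1 * x + - p)) \* (fun x => flat 0 (-1 * x + q))).
  apply: gen_mul; apply: gen_base; first by exists 0%N, 1, (- p).
  by exists 0%N, (-1), q.
by apply/funext => x; rewrite /bump /= mul1r mulN1r [- x + q]addrC.
Qed.

Lemma bump_neq0 p q x : p < x -> x < q -> bump p q x != 0.
Proof.
move=> px xq; rewrite /bump /flat !subr_gt0 px xq !expr0 !mul1r.
by rewrite mulf_neq0 // expR_eq0.
Qed.

Lemma bump_eq0l p q x : x <= p -> bump p q x = 0.
Proof. by move=> xp; rewrite /bump {1}/flat subr_gt0 ltNge xp /= mul0r. Qed.

Lemma bump_eq0r p q x : q <= x -> bump p q x = 0.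
Proof.
by move=> qx; rewrite /bump mulrC {1}/flat subr_gt0 ltNge qx /= mul0r.
Qed.

Lemma derive1n_eq0 n f (U : set R) : open U ->
  (forall x, U x -> f x = 0) -> forall x, U x -> derive1n n f x = 0.
Proof.
move=> oU f0; elim: n => [//|n IH] x Ux.
rewrite derive1nS derive1E (@near_eq_derive _ _ _ _ (cst 0)) ?derive_cst//.
by apply: filterS (open_nbhs_nbhs (conj oU Ux)) => y /IH.
Qed.

(** Outside [p, q] all derivatives vanish, and on [p, q] a continuous function
    attains its maximum: this bounds every weighted derivative. *)
Lemma compact_support_schwartz p q f : smooth f -> p <= q ->
  (forall x, x <= p -> f x = 0) -> (forall x, q <= x -> f x = 0) ->
  (fun x => (f x)%:C%C) \in @schwartz_pred R.
Proof.
move=> sf pq fp fq; apply/mem_set.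
have c0 n : derive1n n (fun=> 0 : R) = fun=> 0.
  elim: n => [//|n IH]; rewrite derive1nS IH.
  by apply/funext => x; rewrite derive1E derive_cst.
split; first by split=> //= n x; rewrite c0; exact: derivable_cst.
move=> k n; pose w x := `|x| ^+ k * `|derive1n n f x|.
have wE : weighted k n (fun x => (f x)%:C%C) = w.
  apply/funext => x; rewrite /weighted /cderiv /= c0.
  by rewrite expr0n addr0 sqrtr_sqr.
have cw : continuous w.
  move=> x; apply: cvgM.
    apply: (@continuous_comp _ _ _ (fun y : R => `|y|) (fun y : R => y ^+ k)).
      exact: norm_continuous.
    exact: exprn_continuous.
  by apply: cvg_norm; apply: smooth_continuous; exact: smooth_derive1n.
have [c _ cmax] := EVT_max pq (continuous_subspaceT cw).
have w0 x : 0 <= w x by rewrite mulr_ge0.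
rewrite wE; exists (w c) => _ [x _ <-].
have out (U : set R) :
    open U -> (forall x, U x -> f x = 0) -> U x -> w x <= w c.
  by move=> oU U0 Ux; rewrite /w (derive1n_eq0 n _ _ oU U0) ?normr0 ?mulr0 ?w0.
have [xp|px] := ltP x p.
  by apply: (out [set y | y < p] (@open_lt _ p)) => // y /= /ltW /fp.
have [qx|xq] := ltP q x.
  by apply: (out [set y | q < y] (@open_gt _ q)) => // y /= /ltW /fq.
by apply: cmax; rewrite in_itv /= px xq.
Qed.

Lemma exists_schwartz_bump p q : p < q -> exists g : schwartz R,
  [/\ forall x, p < x < q -> g x != 0, forall x, x <= p -> g x = 0 &
      forall x, q <= x -> g x = 0].
Proof.
move=> pq; exists (Schwartz (compact_support_schwartz p q (bump p q)
  (bump_smooth p q) (ltW pq) (bump_eq0l p q) (bump_eq0r p q))); split=> x /=.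
- by move=> /andP[px xq]; rewrite fmorph_eq0 bump_neq0.
- by move=> xp; rewrite bump_eq0l.
- by move=> qx; rewrite bump_eq0r.
Qed.

End smooth_functions.

(** * Values of a Schwartz function along orbits *)

Section orbits.
Context {R : realType}.

Lemma decay_cvg0 (w : R -> R) (C : R) (s : nat -> R) :
  (forall x, `|x| * `|w x| <= C) -> `|s n| @[n --> \oo] --> +oo ->
  w (s n) @[n --> \oo] --> (0 : R).
Proof.
move=> wC soo; apply/cvgr0Pnorm_lt => e e0.
near=> n; have sn : Num.max 1 (C / e + 1) <= `|s n|.
  by near: n; move/cvgryPge : soo; apply.
have s0 : 0 < `|s n| by apply: lt_le_trans sn; rewrite lt_max ltr01.
rewrite -(ltr_pM2l s0); apply: le_lt_trans (wC _) _.
rewrite -ltr_pdivrMr//; apply: lt_le_trans sn.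
by rewrite lt_max ltrDl ltr01 orbT.
Unshelve. all: by end_near. Qed.

(** Two interlaced monotone sequences have the same limit: either a real number,
    where [w] is continuous, or infinity, where [w] vanishes. *)
Lemma interlaced_sub_cvg0 (w : R -> R) (C : R) (u v : nat -> R) :
  continuous w -> (forall x, `|x| * `|w x| <= C) ->
  (forall n, u n <= v n <= u n.+1) ->
  w (u n) - w (v n) @[n --> \oo] --> (0 : R).
Proof.
move=> cw wC uv.
have uu : nondecreasing_seq u.
  by apply/nondecreasing_seqP => n; have /andP[] := uv n; exact: le_trans.
rewrite -(subr0 (0 : R)).
have [/cvg_ex[/= l ul]|/(nondecreasing_dvgn_lt uu) uoo] := pselect (cvgn u).
  have vl : v @ \oo --> l.
    apply: (@squeeze_cvgr _ _ _ _ u (fun n => u n.+1)) => //.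
      by near=> n; exact: uv.
    by rewrite (cvg_shiftS u).
  rewrite subr0 -(subrr (w l)).
  apply: cvgB; apply: continuous_cvg => //; exact: cw.
apply: cvgB; apply: decay_cvg0 _ _ _ wC _; apply: (ger_cvgy _ uoo).
  by near=> n; exact: ler_norm.
near=> n; have /andP[un _] := uv n; exact: le_trans un (ler_norm _).
Unshelve. all: by end_near. Qed.

Lemma schwartz_ReIm_decay (f : schwartz R) : exists C, forall x,
  `|x| * `|complex.Re (f x)| <= C /\ `|x| * `|complex.Im (f x)| <= C.
Proof.
exists (seminorm 1 0 f) => x.
have := seminorm_ub 1 0 f x; rewrite /weighted /cderiv /= expr1.
have le (a b : R) : `|a| <= Num.sqrt (a ^+ 2 + b ^+ 2).
  by rewrite -sqrtr_sqr ler_wsqrtr// lerDl sqr_ge0.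
move=> h; split; apply: le_trans h; rewrite ler_wpM2l//.
by rewrite addrC.
Qed.

(** The difference of the values along the two sequences has constant modulus by
    hypothesis and tends to 0 by interlacing, so it vanishes from the start. *)
Lemma schwartz_interlaced_eq (f : schwartz R) (u v : nat -> R) :
  (forall n, u n <= v n <= u n.+1) \/ (forall n, u n.+1 <= v n <= u n) ->
  (forall n, Normc.normc (f (u n.+1) - f (v n.+1)) =
             Normc.normc (f (u n) - f (v n))) ->
  f (u 0%N) = f (v 0%N).
Proof.
move=> uv uvE; have [C fC] := schwartz_ReIm_decay f.
have [fr fi] := schwartz_csmooth f.
have key w : smooth w -> (forall x, `|x| * `|w x| <= C) ->
    w (u n) - w (v n) @[n --> \oo] --> (0 : R).
  move=> sw wC; have cw := smooth_continuous _ sw.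
  case: uv => uv; first exact: interlaced_sub_cvg0 _ _ _ _ cw wC uv.
  (* a decreasing pair becomes an increasing one under x |-> - x *)
  pose w' x := w (- x).
  have -> : (fun n => w (u n) - w (v n)) = (fun n => w' (- u n) - w' (- v n)).
    by apply/funext => n; rewrite /w' !opprK.
  apply: (@interlaced_sub_cvg0 w' C (fun n => - u n) (fun n => - v n)).
  - by move=> x; apply: continuous_comp; [exact: oppr_continuous|exact: cw].
  - by move=> x; rewrite -normrN; exact: wC.
  - by move=> n; rewrite !lerN2 andbC; exact: uv.
have kr := key _ fr (fun x => (fC x).1).
have ki := key _ fi (fun x => (fC x).2).
pose c := Normc.normc (f (u 0%N) - f (v 0%N)).
have cE n : Normc.normc (f (u n) - f (v n)) = c.
  by elim: n => [//|n <-]; exact: uvE.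
have : (fun=> c ^+ 2) @ \oo --> (0 : R).
  rewrite -[X in _ --> X](addr0 0).
  rewrite -[X in X + _](mulr0 0) -[X in _ + X](mulr0 0).
  rewrite (_ : (fun=> c ^+ 2) = fun n =>
    (complex.Re (f (u n)) - complex.Re (f (v n))) *
    (complex.Re (f (u n)) - complex.Re (f (v n))) +
    (complex.Im (f (u n)) - complex.Im (f (v n))) *
    (complex.Im (f (u n)) - complex.Im (f (v n)))).
    by apply: cvgD; apply: cvgM.
  apply/funext => n /=; rewrite -(cE n).
  case: (f (u n)) (f (v n)) => [a b] [a' b'] /=.
  by rewrite sqr_sqrtr ?addr_ge0 ?sqr_ge0// !expr2.
move=> /cvg_lim -/(_ (@norm_hausdorff _ _)); rewrite lim_cst//.
move=> /eqP; rewrite sqrf_eq0 => /eqP /Normc.eq0_normc /eqP.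
by rewrite subr_eq0 => /eqP.
Qed.

(** The forward orbits of [p] and [y] give f (psi p) = f (psi y), the backward
    ones f y = f p, since [k] vanishes at the points of both orbits other than
    [y]; the step from [y] to [psi y] then forces k y = 0.  The invariant set
    [P] contains both orbits: it serves to ask nothing of [k] elsewhere. *)
Lemma cohomological_eq0 (psi theta : R -> R) (f : schwartz R) (mu : R[i])
    (k : R -> R[i]) (P : set R) (p y : R) :
  {homo psi : x z / x <= z} -> {homo theta : x z / x <= z} ->
  cancel theta psi -> cancel psi theta ->
  (forall x, P x -> P (psi x)) -> (forall x, P x -> P (theta x)) ->
  P p -> P y -> p <= y <= psi p ->
  Normc.normc mu = 1 -> (forall x, f (psi x) = mu * f x + k x) ->
  (forall x, P x -> x <= p -> k x = 0) ->
  (forall x, P x -> psi p <= x -> k x = 0) ->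
  k y = 0.
Proof.
move=> psiM thetaM thetaK psiK Ppsi Ptheta Pp Py /andP[py yp] mu1 fE k0l k0r.
have iterM (t : R -> R) n :
    {homo t : x z / x <= z} -> {homo iter n t : x z / x <= z}.
  by move=> tM x z xz; elim: n => //= n IH; exact: tM.
have iterP (t : R -> R) n x :
    (forall x, P x -> P (t x)) -> P x -> P (iter n t x).
  by move=> tP Px; elim: n => //= n IH; exact: tP.
have fwd : f (psi p) = f (psi y).
  pose u x n := iter n psi (psi x).
  have k0 x n : P x -> p <= x -> k (u x n) = 0.
    move=> Px px; apply: k0r; first by apply: iterP => //; exact: Ppsi.
    elim: n => [|n IH]; first exact: psiM.
    exact/psiM/(le_trans (le_trans py yp) IH).
  apply: (@schwartz_interlaced_eq f (u p) (u y)).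
    left=> n; rewrite /u iterSr; apply/andP.
    by split; apply: iterM => //; exact: psiM.
  move=> n; rewrite /u !iterS !fE.
  by rewrite (k0 p n)// (k0 y n)// !addr0 -mulrBr Normc.normcM mu1 mul1r.
have bwd : f y = f p.
  pose u x n := iter n theta x.
  have ty : theta y <= p by rewrite -(psiK p); exact: thetaM.
  have k0 x n : P x -> theta x <= p -> k (u x n.+1) = 0.
    move=> Px xp; apply: k0l; first exact: iterP.
    elim: n => [//|n IH]; apply: le_trans ty; apply: thetaM.
    exact: le_trans IH py.
  apply: (@schwartz_interlaced_eq f (u y) (u p)).
    by right=> n; rewrite /u iterSr; apply/andP; split; apply: iterM.
  have fu x n : P x -> theta x <= p -> f (u x n) = mu * f (u x n.+1).
    by move=> Px xp; rewrite -{1}(thetaK (u x n)) fE (k0 x n)// addr0.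
  move=> n; rewrite (fu y n)// (fu p n)//.
    by rewrite -mulrBr Normc.normcM mu1 mul1r.
  by rewrite (le_trans _ ty)//; exact: thetaM.
have := fE y; rewrite -fwd fE bwd k0l// addr0 => /eqP.
by rewrite addrC -subr_eq subrr => /eqP <-.
Qed.

End orbits.

(** * Decreasing symbols *)

Section symbols.
Context {R : realType} {phi : R -> R} (hphi : symbol phi).

(** If phi (s n) tended to c, a bump g around c would make g (phi (s n)) tend to
    g c != 0, although g o phi is Schwartz and s n leaves every bounded set. *)
Lemma symbol_not_cvgn (s : nat -> R) :
  `|s n| @[n --> \oo] --> +oo -> ~ cvgn (phi \o s).
Proof.
move=> soo /cvg_ex[/= c phic].
have [g [gneq0 _ _]] := @exists_schwartz_bump R (c - 1) (c + 1) ltac:(lra).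
have [C hC] := schwartz_ReIm_decay (comp_op hphi g).
have [gr gi] := schwartz_csmooth g.
have key (w : R -> R) :
    smooth w -> (forall x, `|x| * `|w (phi x)| <= C) -> w c = 0.
  move=> sw wC; have h := decay_cvg0 (w \o phi) C s wC soo.
  have h2 : (w \o phi) (s n) @[n --> \oo] --> w c.
    by apply: continuous_cvg => //; exact: smooth_continuous.
  by have := cvg_unique _ h2 h; apply.
have gr0 := key _ gr (fun x => (hC x).1).
have gi0 := key _ gi (fun x => (hC x).2).
have /negP[] : g c != 0 by apply: gneq0; lra.
by rewrite eq_complex gr0 gi0 !eqxx.
Qed.

Context (phi_decr : forall x y : R, x < y -> phi y < phi x).

(** A monotone function bounded on one side would converge along the integers of
    the corresponding sign, which [symbol_not_cvgn] excludes. *)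
Lemma decr_symbol_surjective d : exists x, phi x = d.
Proof.
have phi_le x y : x <= y -> phi y <= phi x.
  by rewrite le_eqVlt => /orP[/eqP->//|/phi_decr/ltW].
have [n nd] : exists n : nat, phi n%:R < d.
  apply: contrapT => H.
  have dphi n : d <= phi n%:R.
    by rewrite leNgt; apply/negP => h; apply: H; exists n.
  apply: (@symbol_not_cvgn (fun n => n%:R)).
    by under eq_fun do rewrite normr_nat; exact: cvgr_idn.
  apply: nonincreasing_is_cvgn.
    by move=> m n mn; rewrite phi_le// ler_nat.
  by exists d => _ [n _ <-]; exact: dphi.
have [m md] : exists m : nat, d < phi (- m%:R).
  apply: contrapT => H.
  have dphi m : phi (- m%:R) <= d.
    by rewrite leNgt; apply/negP => h; apply: H; exists m.
  apply: (@symbol_not_cvgn (fun n => - n%:R)).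
    by under eq_fun do rewrite normrN normr_nat; exact: cvgr_idn.
  apply: nondecreasing_is_cvgn.
    by move=> i j ij; rewrite phi_le// lerN2 ler_nat.
  by exists d => _ [i _ <-]; exact: dphi.
have mn : - m%:R <= n%:R :> R by rewrite (@le_trans _ _ 0)// oppr_le0.
have cphi := smooth_continuous _ (symbol_smooth hphi).
have [|x _ <-] := @IVT R phi _ _ d mn (continuous_subspaceT cphi);
  last by exists x.
by rewrite ge_min (ltW nd) orbT le_max (ltW md).
Qed.

(** Unless 0 is fixed, phi x - x has opposite signs at 0 and at phi 0, because
    phi reverses the order. *)
Lemma decr_symbol_fixpoint : exists a, phi a = a.
Proof.
have cphi := smooth_continuous _ (symbol_smooth hphi).
pose h x := phi x - x.
have ch : continuous h by move=> x; apply: cvgB; [exact: cphi|exact: cvg_id].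
have root x y : x <= y ->
    Num.min (h x) (h y) <= 0 <= Num.max (h x) (h y) -> exists a, phi a = a.
  move=> xy h0.
  have [a _ /eqP] := @IVT R h x y 0 xy (continuous_subspaceT ch) h0.
  by rewrite subr_eq0 => /eqP pa; exists a.
have [c0|c0|c0] := ltgtP 0 (phi 0).
- apply: (root _ _ (ltW c0)); rewrite ge_min le_max /h subr0 (ltW c0) /=.
  by rewrite subr_le0 (ltW (phi_decr _ _ c0)) orbT.
- apply: (root _ _ (ltW c0)); rewrite ge_min le_max /h subr0 (ltW c0) /=.
  by rewrite subr_ge0 (ltW (phi_decr _ _ c0)) orbT.
- by exists 0.
Qed.

(** The function missed by the range is a bump on a fundamental interval
    [p, psi p] of psi = phi o phi. *)
Lemma unimodular_not_surjective (l : R[i]) :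
  phi \o phi <> id -> Normc.normc l = 1 ->
  exists g : schwartz R, forall f : schwartz R, comp_op hphi f - l *: f <> g.
Proof.
move=> phi2 l1.
have phi_le x y : x <= y -> phi y <= phi x.
  by rewrite le_eqVlt => /orP[/eqP->//|/phi_decr/ltW].
have phi_lt x y : phi x < phi y -> y < x.
  by move=> h; rewrite ltNge; apply/negP => /phi_le; rewrite leNgt h.
have phi_inj : injective phi.
  move=> x y xy; apply/eqP; rewrite eq_le !leNgt; apply/andP.
  by split; apply/negP => /phi_decr; rewrite xy ltxx.
pose psi := phi \o phi.
have [p pp] : exists p : R, p < psi p.
  have [x0 x0P] : exists x, psi x <> x.
    by apply/existsNP => h; apply: phi2; apply/funext.
  have [h|h|h] := ltgtP x0 (psi x0); first by exists x0.
    (* phi conjugates psi to itself and reverses the order *)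
    by exists (phi x0); exact: phi_decr.
  by case: x0P.
have [chi chiK] : exists chi, cancel chi phi.
  by have /choice[chi h] := decr_symbol_surjective; exists chi.
pose theta := chi \o chi.
have thetaK : cancel theta psi by move=> x; rewrite /psi/theta/= !chiK.
have psiK : cancel psi theta by move=> x; apply/phi_inj/phi_inj/thetaK.
have psiM : {homo psi : x z / x <= z} by move=> x z /phi_le /phi_le.
have psi_lt x z : x < z -> psi x < psi z by move=> /phi_decr /phi_decr.
have psi_gt x z : psi x < psi z -> x < z by move=> /phi_lt /phi_lt.
have thetaM : {homo theta : x z / x <= z}.
  move=> x z xz; rewrite leNgt; apply/negP => /psi_lt.
  by rewrite !thetaK ltNge xz.
have [a pa] := decr_symbol_fixpoint.
have psia : psi a = a by rewrite /psi /= !pa.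
(* P is the side of the fixed point on which p lies; phi sends it to the other
   side, away from [p, psi p] *)
have [P [Ppsi Ptheta Pp Pphi]] : exists P : set R,
   [/\ forall x, P x -> P (psi x), forall x, P x -> P (theta x),
       forall y, p <= y <= psi p -> P y &
       forall x, P x -> phi x <= p \/ psi p <= phi x].
  have [ap|ap|ap] := ltgtP a p.
  - exists [set x | a < x]; split=> x /=.
    + by move=> /psi_lt; rewrite psia.
    + by move=> ax; apply: psi_gt; rewrite psia thetaK.
    + by move=> /andP[+ _]; exact: lt_le_trans.
    + by move=> /phi_decr; rewrite pa => xa; left; exact: ltW (lt_trans xa ap).
  - exists [set x | x < a]; split=> x /=.
    + by move=> /psi_lt; rewrite psia.
    + by move=> ax; apply: psi_gt; rewrite psia thetaK.
    + move=> /andP[_ xp]; apply: le_lt_trans xp _.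
      by rewrite -psia; exact: psi_lt.
    + move=> /phi_decr; rewrite pa => xa; right; apply: ltW (lt_trans _ xa).
      by rewrite -psia; exact: psi_lt.
  - by move: pp; rewrite -ap psia ltxx.
have [g [gneq0 g0l g0r]] := exists_schwartz_bump _ _ pp.
have gphi x : P x -> g (phi x) = 0 by move=> /Pphi [/g0l|/g0r].
exists g => f fg.
have fgE x : f (phi x) = l * f x + g x.
  rewrite -fg [X in _ + X](_ : _ = f (phi x) - l * f x)//.
  by rewrite addrC subrK.
pose y := (p + psi p) / 2.
have py : p < y by rewrite /y; lra.
have yp : y < psi p by rewrite /y; lra.
have Py : P y by apply: Pp; rewrite !ltW.
have := @cohomological_eq0 R psi theta f (l ^+ 2)
  (fun x => l * g x + g (phi x)) P p y psiM thetaM thetaK psiK Ppsi Ptheta.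
rewrite gphi// addr0.
have Ppp : P p by apply: Pp; rewrite lexx ltW.
have ypp : p <= y <= psi p by rewrite !ltW.
move=> /(_ Ppp Py ypp); rewrite expr2 Normc.normcM l1 mulr1 => /(_ erefl) H.
have /eqP : l * g y = 0.
  apply: H => x; first by rewrite /psi/= !fgE mulrDr mulrA addrA.
    by move=> Px xp; rewrite g0l// mulr0 add0r gphi.
  by move=> Px xp; rewrite g0r// mulr0 add0r gphi.
rewrite mulf_eq0 (negbTE (gneq0 _ _)) ?py// orbF => /eqP l0.
by move/eqP : l1; rewrite l0 Normc.normc0 eq_sym oner_eq0.
Qed.

End symbols.

(** * Involutions *)

(** With T f = g and T g = f, this identity and the next one say that
    (1 - l ^+ 2)^-1 (T + l) is a left and a right inverse of T - l.  They are
    separate from T because they concern the vectors f and g only. *)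
Lemma invol_left_inverse (K : fieldType) (V : lmodType K) (l : K) (f g : V) :
  l ^+ 2 != 1 -> (1 - l ^+ 2)^-1 *: (f - l *: g + l *: (g - l *: f)) = f.
Proof.
move=> l2; rewrite scalerBr addrA subrK scalerA -{1}[f]scale1r -scalerBl.
rewrite scalerA.
by rewrite -expr2 mulVf ?scale1r// subr_eq0 eq_sym.
Qed.

Lemma invol_right_inverse (K : fieldType) (V : lmodType K) (l : K) (f g : V) :
  l ^+ 2 != 1 -> (1 - l ^+ 2)^-1 *: (f + l *: g) -
    l *: ((1 - l ^+ 2)^-1 *: (g + l *: f)) = f.
Proof.
move=> l2; rewrite -[RHS](@invol_left_inverse _ _ l f g)//.
rewrite scalerA [l * _]mulrC -scalerA -scalerBr; congr (_ *: _).
by rewrite scalerDr scalerBr opprD addrA addrK addrA subrK.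
Qed.

Lemma not_spectrum_involution (K : numFieldType) (E : tvsType K)
    (T : {linear E -> E}) (l : K) :
  continuous T -> (forall f, T (T f) = f) -> l ^+ 2 != 1 -> ~ spectrum T l.
Proof.
move=> cT TT l2; apply; pose c := (1 - l ^+ 2)^-1.
pose S f := c *: (T f + l *: f).
have Slin : linear S.
  move=> a f g; rewrite /S linearP scalerA [_ * c]mulrC -scalerA -scalerDr.
  congr (_ *: _); rewrite scalerDr addrACA; congr (_ + _).
  by rewrite !scalerDr !scalerA [a * l]mulrC.
have contZ (b : K) : continuous (fun f : E => b *: f).
  move=> f; apply: (@continuous_comp _ _ _ (fun f : E => ((b : K^o), f))
    (fun z => z.1 *: z.2)).
    exact: (@cvg_pair _ _ _ _ (nbhs (b : K^o)) (nbhs f) _ _ _ _ _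
      (cvg_cst _) cvg_id).
  exact: scale_continuous.
have cS : continuous S.
  have cTl : continuous (fun f => T f + l *: f).
    move=> f; apply: (@continuous_comp _ _ _ (fun f => (T f, l *: f))
      (fun z => z.1 + z.2)).
      exact: (@cvg_pair _ _ _ _ (nbhs (T f)) (nbhs (l *: f)) _ _ _ _ _
        (cT f) (contZ l f)).
    exact: add_continuous.
  move=> f.
  apply: (@continuous_comp _ _ _ (fun f => T f + l *: f) _ f (cTl f)).
  exact: contZ.
have SK (f : E) : S (T f - l *: f) = f.
  by rewrite /S linearB linearZ /= TT; exact: invol_left_inverse.
have KS (f : E) : T (S f) - l *: S f = f.
  by rewrite /S linearZ linearD linearZ /= TT; exact: invol_right_inverse.
pose SL : {linear E -> E} := HB.pack S (GRing.isLinear.Build _ _ _ _ S Slin).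
by exists SL; split.
Qed.

(** * The spectrum of the composition operator *)

Theorem proposition5p5 (R : realType) (phi : R -> R) (hphi : symbol phi)
    (phi_decr : forall x y : R, x < y -> phi y < phi x) :
  [set l : R[i] | `|l| = 1] `<=` spectrum (comp_op hphi) <->
  phi \o phi <> id.

Proof.
split=> [circle phi2|phi2 l /= l1 [S [_ _ SK]]].
  have i1 : `|Complex 0 1 : R[i]| = 1.
    by apply/eqP; rewrite eq_complex /= expr0n expr1n add0r sqrtr1 !eqxx.
  have i2 : (Complex 0 1 : R[i]) ^+ 2 != 1.
    have -> : (Complex 0 1 : R[i]) ^+ 2 = -1.
      apply/eqP; rewrite expr2 eq_complex /=.
      by apply/andP; split; apply/eqP; ring.
    by rewrite eq_sym -subr_eq0 opprK -[1 + 1]/(2%:R) pnatr_eq0.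
  have TT (f : schwartz R) : comp_op hphi (comp_op hphi f) = f.
    apply: val_inj; apply/funext => x.
    by rewrite -[in RHS](_ : (phi \o phi) x = x)// phi2.
  apply: (@not_spectrum_involution _ _ (comp_op hphi) (Complex 0 1)) (circle _ i1)
    => //.
  exact: (@symbol_continuous _ _ hphi).
have normc1 : Normc.normc l = 1 by apply: complexI.
have [g gP] := unimodular_not_surjective hphi phi_decr l phi2 normc1.
exact: (gP _ (SK g)).
Qed.
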